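(* Let $\mathcal{V}$ be a finite set of Boolean variables, and let $\phi^{inv}_1=\mathbf{G}\,B_1(\mathcal{V}\cup\mathbf{X}\mathcal{V})$ and $\phi^{inv}_2=\mathbf{G}\,B_2(\mathcal{V}\cup\mathbf{X}\mathcal{V})$ be two invariants with non-empty languages such that $\phi^{inv}_1\rightarrow\phi^{inv}_2$ is valid, $\phi^{inv}_2\rightarrow\phi^{inv}_1$ is not valid, and $L(\phi^{inv}_2)$ is strongly connected. Then $\dim(L(\phi^{inv}_1))<\dim(L(\phi^{inv}_2))$.
   Context: Formulae are interpreted over $\omega$-words $w=w_1w_2\dots$ over $\Sigma=2^{\mathcal{V}}$; $L(\phi)$ is the set of $\omega$-words satisfying $\phi$; a formula is valid if every $\omega$-word satisfies it. $B(\mathcal{V}\cup\mathbf{X}\mathcal{V})$ denotes a pure Boolean expression over the atoms $p$ and $\mathbf{X}p$ for $p\in\mathcal{V}$; $w\models p$ iff $p\in w_1$, $w\models\mathbf{X}p$ iff $p\in w_2$, and $w\models\mathbf{G}\psi$ iff every suffix $w^j=w_jw_{j+1}\dots$ satisfies $\psi$. For $L\subseteq\Sigma^\omega$, $A(L)$ is the set of finite prefixes of words of $L$, and for $u\in A(L)$, $S_u(L)=\{v\in\Sigma^\omega: uv\in L\}$. $L$ is strongly connected if for every $u\in A(L)$ there is a finite word $v\in\Sigma^*$ with $S_{uv}(L)=L$. Let $r=|\Sigma|$. The $\alpha$-dimensional Hausdorff outer measure is $m_\alpha(L)=\lim_{n\to\infty}\inf_{V\in\mathcal{L}_n}\sum_{v\in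 V}r^{-\alpha|v|}$, where $\mathcal{L}_n$ is the collection of sets $V\subseteq\Sigma^*$ of words of length at least $n$ such that every word of $L$ has a prefix in $V$; the Hausdorff dimension $\dim(L)$ is the unique $\bar\alpha$ with $m_\alpha(L)=\infty$ for $\alpha<\bar\alpha$ and $m_\alpha(L)=0$ for $\alpha>\bar\alpha$. *)

(* Defs.v *)
From HB Require Import structures.
From mathcomp Require Import all_boot all_order all_algebra.
From mathcomp Require Import all_classical all_reals all_analysis.
Set Implicit Arguments. Unset Strict Implicit. Unset Printing Implicit Defensive.
Import Order.TTheory GRing.Theory Num.Theory.
Local Open Scope classical_set_scope.
Local Open Scope ring_scope.

(* Alphabet Sigma = 2^V, represented as {set V}; omega-words are nat -> Sigma
   (w 0 is the paper's w_1); finite words are seq Sigma. *)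
Definition letter (V : finType) := {set V}.
Definition oword (V : finType) := nat -> letter V.
Definition fword (V : finType) := seq (letter V).

Inductive bexp (V : Type) :=
| BTrue
| BVar of V
| BNext of V
| BNot of bexp V
| BAnd of bexp V & bexp V
| BOr of bexp V & bexp V.

(* value of B on a word whose first two letters are a, b *)
Fixpoint beval (V : finType) (B : bexp V) (a b : letter V) : bool :=
  match B with
  | BTrue => true
  | BVar p => p \in a
  | BNext p => p \in b
  | BNot B1 => ~~ beval B1 a b
  | BAnd B1 B2 => beval B1 a b && beval B2 a b
  | BOr B1 B2 => beval B1 a b || beval B2 a b
  end.

Definition sat_inv (V : finType) (B : bexp V) (w : oword V) : Prop :=
  forall j : nat, beval B (w j) (w j.+1).

Definition Linv (V : finType) (B : bexp V) : set (oword V) := [set w | sat_inv B w].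

Definition pre (V : finType) (w : oword V) (n : nat) : fword V := [seq w i | i <- iota 0 n].
Definition is_prefix (V : finType) (u : fword V) (w : oword V) : Prop := u = pre w (size u).

Definition catw (V : finType) (u : fword V) (v : oword V) : oword V :=
  fun i => if (i < size u)%N then nth (@finset.set0 V) u i else v (i - size u)%N.

Definition A_of (V : finType) (L : set (oword V)) : set (fword V) :=
  [set u | exists2 w, L w & is_prefix u w].
Definition S_of (V : finType) (u : fword V) (L : set (oword V)) : set (oword V) :=
  [set v | L (catw u v)].

Definition strongly_connected (V : finType) (L : set (oword V)) : Prop :=
  forall u, A_of L u -> exists v : fword V, S_of (u ++ v) L = L.

Definition r_of (V : finType) : nat := #|{: letter V}|.

Definition covers (V : finType) (L : set (oword V)) (n : nat) : set (set (fword V)) :=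
  [set C | (forall v, C v -> (n <= size v)%N) /\
           (forall w, L w -> exists2 v, C v & is_prefix v w)].

Definition hmeasure (R : realType) (V : finType) (alpha : R) (L : set (oword V)) : \bar R :=
  limn (fun n : nat =>
    ereal_inf [set (\esum_(v in C) ((r_of V)%:R `^ (- (alpha * (size v)%:R)))%:E)%E
              | C in covers L n]).

Definition is_hdim (R : realType) (V : finType) (L : set (oword V)) (dbar : R) : Prop :=
  (forall alpha : R, alpha < dbar -> hmeasure alpha L = +oo%E) /\
  (forall alpha : R, dbar < alpha -> hmeasure alpha L = 0%E).

(* Main.v *)
(* The finite prefixes of the words satisfying an invariant are the paths of a finite
   graph on the letters. Write N1(n), N2(n) for the numbers of prefixes of length n.
   Strong connectivity of the larger language makes its graph primitive, and the smaller
   graph misses one of its edges, so for some M the M-step path counts of the smaller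
   graph are entrywise at most rho < 1 times those of the larger one, and
   N1(M k + 1) <= rho^k N2(M k + 1). If m_alpha(L2) = 0, then cutting the words of L2
   along a finite cover of weight at most 1 gives N2(n) <= K r^(alpha n), so the trivial
   covers by all prefixes of a given length show m_(alpha - delta)(L1) = 0, where delta
   depends only on M and rho. *)
Require Import Defs.
From HB Require Import structures.
From mathcomp Require Import all_boot all_order all_algebra.
From mathcomp Require Import all_classical all_reals all_analysis.
From mathcomp Require Import ring lra.
Import Order.TTheory GRing.Theory Num.Theory.
Local Open Scope classical_set_scope.
Local Open Scope ring_scope.
Set Implicit Arguments.
Unset Strict Implicit.
Unset Printing Implicit Defensive.

(** * Counting walks *)

Fixpoint words (T : finType) (n : nat) : seq (seq T) :=
  if n is n'.+1 then [seq x :: s | x <- index_enum T, s <- words T n'] else [:: [::]].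

Lemma mem_words (T : finType) n (s : seq T) : (s \in words T n) = (size s == n).
Proof.
elim: n s => [|n IHn] [|x s] //=; first by apply/negbTE/allpairsP => -[[]] ? ? [].
rewrite eqSS -IHn; apply/allpairsP/idP => [[[y t]] /= [_ ts [_ ->]] //|xs].
by exists (x, s); rewrite mem_index_enum.
Qed.

Lemma words_uniq (T : finType) n : uniq (words T n).
Proof.
elim: n => //= n IHn; apply: allpairs_uniq; rewrite ?index_enum_uniq //.
by move=> [x s] [y t] _ _ /= [-> ->].
Qed.

Lemma count_words (T : finType) (P : pred (seq T)) n :
  count P (words T n.+1) = (\sum_x count (fun s => P (x :: s)) (words T n))%N.
Proof.
rewrite /= count_flatten sumnE !big_map.
by apply: eq_bigr => x _; rewrite count_map.
Qed.

Definition walks (T : finType) (e : rel T) (n : nat) (x y : T) : nat :=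
  count (fun s => path e x s && (last x s == y)) (words T n).

Lemma walks0 (T : finType) (e : rel T) x y : walks e 0 x y = (x == y).
Proof. by rewrite /walks /= addn0. Qed.

Lemma walksS (T : finType) (e : rel T) n x y :
  walks e n.+1 x y = (\sum_z e x z * walks e n z y)%N.
Proof.
rewrite /walks count_words; apply: eq_bigr => z _ /=.
case: (e x z); last by rewrite mul0n; apply/eqP; rewrite -leqn0 leqNgt -has_count; apply/hasPn.
by rewrite mul1n.
Qed.

Lemma walks1 (T : finType) (e : rel T) x y : walks e 1 x y = e x y.
Proof.
rewrite walksS (bigD1 y) //= walks0 eqxx muln1 big1 ?addn0 // => z /negbTE zy.
by rewrite walks0 zy muln0.
Qed.

Lemma walksD (T : finType) (e : rel T) m n x y :
  walks e (m + n) x y = (\sum_z walks e m x z * walks e n z y)%N.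
Proof.
elim: m x => [|m IHm] x.
  rewrite (bigD1 x) //= walks0 eqxx mul1n big1 ?addn0 // => z /negbTE zx.
  by rewrite walks0 eq_sym zx.
rewrite addSn walksS.
under eq_bigr do rewrite IHm big_distrr.
under [in RHS]eq_bigr do rewrite walksS big_distrl.
by rewrite exchange_big; do 2 (apply: eq_bigr => ? _); rewrite /= mulnA.
Qed.

Lemma count_path (T : finType) (e : rel T) n x :
  count (path e x) (words T n) = (\sum_y walks e n x y)%N.
Proof.
rewrite -sum1_count (partition_big (last x) xpredT) //=.
by apply: eq_bigr => y _; rewrite sum1_count; apply: eq_count => s.
Qed.

Lemma walks_le (T : finType) (e1 e2 : rel T) n x y :
  subrel e1 e2 -> (walks e1 n x y <= walks e2 n x y)%N.
Proof.
move=> e12; apply: sub_count => s /andP[+ /= ->].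
by move=> /(sub_path e12) ->.
Qed.

Lemma walks_trans (T : finType) (e : rel T) m n x y z :
  (0 < walks e m x y -> 0 < walks e n y z -> 0 < walks e (m + n) x z)%N.
Proof. by move=> xy yz; rewrite walksD (bigD1 y) //= addn_gt0 muln_gt0 xy yz. Qed.

Lemma walks_gt0 (T : finType) (e : rel T) x s :
  path e x s -> (0 < walks e (size s) x (last x s))%N.
Proof.
move=> xs; rewrite -has_count; apply/hasP; exists s; rewrite ?mem_words //=.
by rewrite xs eqxx.
Qed.

Lemma walks_expn (T : finType) (e1 e2 : rel T) M c d :
  (forall x y, c * walks e1 M x y <= d * walks e2 M x y)%N ->
  forall k x y, (c ^ k * walks e1 (M * k) x y <= d ^ k * walks e2 (M * k) x y)%N.
Proof.
move=> cd; elim=> [|k IHk] x y; first by rewrite muln0 !walks0.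
rewrite mulnS !walksD !big_distrr /=; apply: leq_sum => z _.
by rewrite !expnS !(mulnACA _ _ (walks _ _ _ _)) leq_mul.
Qed.

(* The matrix [walks e2 M] is entrywise larger than [walks e1 M] on [D] because
   every pair in [D] is joined by an [e2]-walk of length [M] through [(p, q)]. *)
Lemma walks_contraction (T : finType) (e1 e2 : rel T) (D : pred T) (a p q : T) :
  subrel e1 e2 ->
  (forall x y, e2 x y -> D x && D y) ->
  D a -> (forall z, D z -> e2 a z) ->
  (forall z, D z -> exists n, 0 < walks e2 n z a)%N ->
  e2 p q -> ~~ e1 p q ->
  exists M c, [/\ (0 < M)%N, (0 < c)%N & forall k x y,
    (c.+1 ^ k * walks e1 (M * k) x y <= c ^ k * walks e2 (M * k) x y)%N].
Proof.
move=> e12 e2D Da ea toa e2pq e1pq.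
(* The loop at [a] lengthens any walk ending there, so the largest of finitely many lengths serves
   every [z] in [D]. *)
have [K toaK] : exists K, forall z, D z -> (0 < walks e2 K z a)%N.
  have /choice[f fP] : forall z, exists n, D z ==> (0 < walks e2 n z a)%N.
    move=> z; have [/toa[n zn]|_] := boolP (D z); first by exists n.
    by exists 0%N.
  have pad z n m : (0 < walks e2 n z a -> 0 < walks e2 (n + m) z a)%N.
    move=> zn; apply: walks_trans zn _; elim: m => [|m IHm].
      by rewrite walks0 eqxx.
    by rewrite -(addn1 m); apply: walks_trans IHm _; rewrite walks1 ea.
  exists (\max_z f z) => z Dz.
  by rewrite -(subnKC (leq_bigmax z)); apply: pad; apply: (implyP (fP z)).
have /andP[Dp Dq] := e2D _ _ e2pq.
(* [K.+1] steps lead to [p] ([K] to [a], then one to any vertex of [D]), one crosses the edge from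
   [p] to [q], and [K.+1] lead from [q] to the target. *)
set M := (K.+1 + (1 + K.+1))%N.
have thru x y : D x -> D y -> (0 < walks e2 K.+1 x y)%N.
  move=> Dx Dy; rewrite -(addn1 K); apply: walks_trans (toaK x Dx) _.
  by rewrite walks1 ea.
have lt12 x y : D x -> D y -> (walks e1 M x y < walks e2 M x y)%N.
  move=> Dx Dy; rewrite !walksD (bigD1 p) //= [X in (_ < X)%N](bigD1 p) //=.
  rewrite -addSn leq_add //; last first.
    by apply: leq_sum => z _; rewrite leq_mul // walks_le.
  apply: (@leq_ltn_trans (walks e2 K.+1 x p * walks e1 (1 + K.+1) p y)%N).
    by rewrite leq_mul2r walks_le // orbT.
  rewrite ltn_pmul2l ?thru // !walksD (bigD1 q) //= [X in (_ < X)%N](bigD1 q) //=.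
  rewrite -addSn leq_add //; last first.
    by apply: leq_sum => z _; rewrite leq_mul // walks_le.
  by rewrite !walks1 (negbTE e1pq) e2pq mul1n thru.
(* For entries u < v <= c: (c+1)u <= cu + c = c(u+1) <= cv. The successor keeps [c] positive. *)
pose c := (\max_x \max_y walks e2 M x y).+1.
exists M, c; split=> //; apply: walks_expn => x y.
have [/andP[Dx Dy]|] := boolP (D x && D y).
  have lec : (walks e2 M x y <= c)%N.
    apply: leqW; apply: leq_trans (leq_bigmax x).
    by rewrite (leq_bigmax (F := walks e2 M x) y).
  have := lt12 x y Dx Dy; rewrite mulSn.
  move: (walks e1 M x y) (walks e2 M x y) lec => u v vc uv.
  apply: (@leq_trans (c * u.+1)%N); last by rewrite leq_mul2l uv orbT.
  by rewrite mulnS leq_add2r (leq_trans (ltnW uv)).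
(* Outside [D] the left side vanishes: the first and last edges of an [e1]-walk of positive length
   put both its ends in [D]. *)
have -> : M = (K.+1 + K.+1).+1 by rewrite /M addnCA.
move=> nD; suff -> : walks e1 (K.+1 + K.+1).+1 x y = 0%N by rewrite muln0.
apply/eqP; rewrite eqn0Ngt; apply: contra nD => xy.
apply/andP; split.
  move: xy; rewrite walksS lt0n sum_nat_eq0 negb_forall => /existsP[z].
  by case: (boolP (e1 x z)) => // /e12 /e2D/andP[].
move: xy; rewrite -(addn1 (_ + _)) walksD lt0n sum_nat_eq0 negb_forall => /existsP[z].
by rewrite walks1; case: (boolP (e1 z y)); rewrite ?muln0 // => /e12/e2D/andP[].
Qed.

(** * Prefixes and shifts of omega-words *)

Definition shift (V : finType) (n : nat) (w : oword V) : oword V :=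
  fun i => w (n + i)%N.

Definition consw (V : finType) (x : letter V) (w : oword V) : oword V :=
  fun i => if i is j.+1 then w j else x.

Lemma size_pre (V : finType) (w : oword V) n : size (pre w n) = n.
Proof. by rewrite size_map size_iota. Qed.

Lemma preD (V : finType) (w : oword V) m n :
  pre w (m + n) = pre w m ++ pre (shift m w) n.
Proof.
by rewrite /pre iotaD map_cat add0n -[X in iota X n]addn0 iotaDl -map_comp.
Qed.

Lemma pre_catw (V : finType) (u : fword V) (w : oword V) : is_prefix u (catw u w).
Proof.
rewrite /is_prefix; apply: (@eq_from_nth _ finset.set0); rewrite ?size_pre // => i iu.
by rewrite (nth_map 0%N) ?size_iota // nth_iota // /catw iu.
Qed.

Lemma sat_inv_shift (V : finType) (B : bexp V) n w : sat_inv B w -> sat_inv B (shift n w).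
Proof. by move=> Bw j; rewrite /shift addnS. Qed.

Definition language_size (V : finType) (L : set (oword V)) (n : nat) : nat :=
  count (fun s => `[<A_of L s>]) (words (letter V) n).

Definition shift_invariant (V : finType) (L : set (oword V)) :=
  forall w n, L w -> L (shift n w).

(** Closedness in the product topology on omega-words, needed for the compactness argument. *)
Definition prefix_closed_language (V : finType) (L : set (oword V)) :=
  forall w, (forall n, A_of L (pre w n)) -> L w.

Lemma Linv_shift_invariant (V : finType) (B : bexp V) : shift_invariant (Linv B).
Proof. by move=> w n; apply: sat_inv_shift. Qed.

Lemma Linv_closed (V : finType) (B : bexp V) : prefix_closed_language (Linv B).
Proof.
(* The constraint at [j] reads the letters [j] and [j.+1], both inside the prefix of length
   [j.+2]. *)
move=> w Aw j; have [w' Bw'] := Aw j.+2.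
rewrite /is_prefix size_pre => eqw.
have nthw (v : oword V) i : (i < j.+2)%N -> nth finset.set0 (pre v j.+2) i = v i.
  by move=> ij; rewrite (nth_map 0%N) ?size_iota // nth_iota.
by rewrite -(nthw w) // -(nthw w j.+1) // eqw !nthw.
Qed.

(** * Transition graph of an invariant *)

Definition live (V : finType) (B : bexp V) (x : letter V) : bool :=
  `[< exists2 w, Linv B w & w 0%N = x >].

(** Requiring live ends prunes dead ends, so that every path extends to a word of the language. *)
Definition edge (V : finType) (B : bexp V) (x y : letter V) : bool :=
  [&& live B x, live B y & beval B x y].

Lemma live_Linv (V : finType) (B : bexp V) w j : Linv B w -> live B (w j).
Proof.
by move=> Bw; apply/asboolP; exists (shift j w); [exact: sat_inv_shift | rewrite /shift addn0].
Qed.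

Lemma edge_Linv (V : finType) (B : bexp V) w j : Linv B w -> edge B (w j) (w j.+1).
Proof. by move=> Bw; rewrite /edge !live_Linv //; apply: Bw. Qed.

(** Constraints link adjacent letters only, so any [x] with an edge to [y] may be put in front of a
    word starting with [y]. *)
Lemma A_of_Linv (V : finType) (B : bexp V) x s :
  A_of (Linv B) (x :: s) <-> live B x && path (edge B) x s.
Proof.
elim: s x => [|y s IHs] x; split.
- by case=> w Bw [->]; rewrite live_Linv.
- by rewrite andbT => /asboolP[w Bw <-]; exists w.
- case=> w Bw; rewrite /is_prefix /= => -[-> -> ws].
  have /IHs/andP[_ p] : A_of (Linv B) (w 1%N :: s).
    exists (shift 1 w); first exact: sat_inv_shift.
    by rewrite /is_prefix /= {1}ws /pre /= (iotaDl 1 1) -map_comp.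
  by rewrite live_Linv //= edge_Linv.
- rewrite /= => /and3P[_ /and3P[lx ly xy] p].
  have /IHs[w Bw] : live B y && path (edge B) y s by rewrite ly.
  move=> yw; have w0 : w 0%N = y by case: yw.
  exists (consw x w) => [[|j] /=|]; rewrite ?w0 //.
  rewrite /is_prefix -[size _]/(1 + size (y :: s))%N preD.
  by rewrite yw size_pre.
Qed.

(** A prefix with n+1 letters is a path with n edges, whence the index shift. *)
Lemma language_sizeS (V : finType) (B : bexp V) n :
  language_size (Linv B) n.+1 = (\sum_(x | live B x) \sum_y walks (edge B) n x y)%N.
Proof.
rewrite /language_size count_words [RHS]big_mkcond; apply: eq_bigr => x _.
rewrite -count_path; case: ifPn => lx.
  apply: eq_count => s; apply/asboolP/idP.
    by move/A_of_Linv/andP => [].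
  by move=> p; apply/A_of_Linv; rewrite lx.
rewrite -(count_pred0 (words (letter V) n)); apply: eq_count => s /=.
by apply/asboolP => /A_of_Linv; rewrite (negbTE lx).
Qed.

(* Reading a full letter imposes no constraint on the rest of the word; strong
   connectivity of [Linv B] makes the last letter of [u ++ v] full. *)
Lemma full_letter (V : finType) (B : bexp V) :
  Linv B !=set0 -> strongly_connected (Linv B) ->
  exists a, [/\ live B a, (forall z, live B z -> edge B a z) &
    forall z, live B z -> exists n, (0 < walks (edge B) n z a)%N].
Proof.
move=> [w0 Bw0] sc.
have toFull z : live B z -> exists s, path (edge B) z s /\
    forall y, live B y -> edge B (last z s) y.
  move=> lz; have /sc[v Sv] : A_of (Linv B) [:: z] by apply/A_of_Linv; rewrite lz.
  exists v; have Bcat w : Linv B w -> Linv B (catw (z :: v) w).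
    by rewrite -{1}Sv.
  split.
    have /A_of_Linv/andP[] // : A_of (Linv B) (z :: v).
    by exists (catw (z :: v) w0); [exact: Bcat | exact: pre_catw].
  (* Position [size v] of [catw (z :: v) w] holds the last letter of [z :: v], and the next one is
     [y]. *)
  move=> y /asboolP[w Bw wy]; have := edge_Linv (size v) (Bcat w Bw).
  by rewrite /catw /= ltnSn ltnn subnn wy (last_nth finset.set0).
have [s [ps fulls]] := toFull _ (live_Linv 0 Bw0).
set a := last (w0 0%N) s in fulls.
have la : live B a by have /and3P[] := fulls _ (live_Linv 0 Bw0).
exists a; split=> // z /toFull[t [pt fullt]].
exists (size t + 1)%N; apply: walks_trans (walks_gt0 pt) _.
by rewrite walks1 fullt.
Qed.

(** * Finite subcovers and counting *)

(** König's lemma: if no bound works, [bad] prefixes can be extended forever, and their limit lies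
    in the closed language [L] but contradicts the cover. *)
Lemma finite_subcover (V : finType) (L : set (oword V)) (C : set (fword V)) :
  prefix_closed_language L ->
  (forall w, L w -> exists2 v, C v & is_prefix v w) ->
  exists l, forall w, L w -> exists v, [/\ C v, (size v <= l)%N & is_prefix v w].
Proof.
move=> Lcl CL; apply: contrapT => /forallNP noL.
pose good l w := exists v, [/\ C v, (size v <= l)%N & is_prefix v w].
pose bad u := forall l, exists w, [/\ L w, is_prefix u w & ~ good l w].
have bad0 : bad [::].
  move=> l; have /existsNP[w /not_implyP[Lw gw]] := noL l.
  by exists w.
have badS u : exists a, bad u -> bad (rcons u a).
  have [bu|nbu] := pselect (bad u); last by exists finset.set0.
  apply: contrapT => /forallNP nb.
  (* If no one-letter extension were bad, the maximum of their finitely many bounds would be a bound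
     for [u]. *)
  have /choice[f fP] a : exists l, forall w, L w -> is_prefix (rcons u a) w -> good l w.
    have /not_implyP[_ /existsNP[l /forallNP nl]] := nb a.
    exists l => w Lw ua; apply: contrapT => gw; exact: (nl w).
  have [w [Lw uw]] := bu (\max_a f a)%N; apply.
  have /fP[] // : is_prefix (rcons u (w (size u))) w.
    rewrite /is_prefix size_rcons -addn1 preD -uw cats1.
    by rewrite /shift /= addn0.
  move=> v [Cv lv vw]; exists v; split=> //.
  exact: leq_trans lv (leq_bigmax _).
have /choice[f fP] := badS.
pose U n := iter n (fun u => rcons u (f u)) [::].
pose w n := f (U n).
have preU n : pre w n = U n.
  by elim: n => // n IHn; rewrite -addn1 preD IHn addn1 /= cats1 /shift /= addn0.
have badU n : bad (pre w n).
  by rewrite preU; elim: n => //= n IHn; apply: fP.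
have Lw : L w.
  by apply: Lcl => n; have [w' [Lw' nw' _]] := badU n 0%N; exists w'.
have [v Cv vw] := CL w Lw.
have [w' [_ vw' []]] := badU (size v) (size v).
by exists v; split=> //; rewrite /is_prefix {1}vw vw' size_pre.
Qed.

(** Cutting off a prefix in [C] leaves a shorter prefix of a shifted word, which is again in [L]. *)
Lemma language_size_cover (V : finType) (L : set (oword V)) (C : seq (fword V)) n :
  shift_invariant L ->
  (forall w, L w -> exists2 v, v \in C & is_prefix v w) ->
  (forall v, v \in C -> size v <= n)%N ->
  (language_size L n <= \sum_(v <- C) language_size L (n - size v))%N.
Proof.
move=> Lsh CL Cn; pose A k := [seq s <- words (letter V) k | `[<A_of L s>]].
have sA k : size (A k) = language_size L k by rewrite size_filter.
rewrite -sA.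
apply: (@leq_trans (size (flatten [seq [seq v ++ t | t <- A (n - size v)%N] | v <- C]))).
  apply: uniq_leq_size; first by rewrite filter_uniq // words_uniq.
  move=> s; rewrite mem_filter mem_words => /andP[/asboolP[w Lw sw] /eqP sn].
  have [v Cv vw] := CL w Lw.
  apply/flatten_mapP; exists v => //; apply/mapP.
  exists (pre (shift (size v) w) (n - size v)).
    rewrite mem_filter mem_words size_pre eqxx andbT; apply/asboolP.
    by exists (shift (size v) w); [exact: Lsh | rewrite /is_prefix size_pre].
  by rewrite {1}vw -preD subnKC ?Cn // sw sn.
rewrite size_flatten /shape sumnE !big_map; apply: leq_sum => v _.
by rewrite size_map sA.
Qed.

(* Furstenberg's argument: decomposing the words of a shift-invariant language along
   a finite cover bounds their number. *)
Lemma language_size_bound (R : realType) (V : finType) (L : set (oword V))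
    (C : seq (fword V)) (x : R) :
  0 < x -> shift_invariant L ->
  (forall w, L w -> exists2 v, v \in C & is_prefix v w) ->
  (forall v, v \in C -> 0 < size v)%N ->
  \sum_(v <- C) x ^+ size v <= 1 ->
  exists K, forall n, (language_size L n)%:R * x ^+ n <= K.
Proof.
move=> x0 Lsh CL C0 Cx; pose l := (\max_(v <- C) size v)%N.
(* This [K] dominates each term with n < l. For n >= l every word of [C] fits into length n, and
   induction gives at most K times the weight of [C]. *)
pose K := \sum_(i < l) (language_size L i)%:R * x ^+ i.
have term_ge0 i : 0 <= (language_size L i)%:R * x ^+ i.
  by rewrite mulr_ge0 // exprn_ge0 // ltW.
have K0 : 0 <= K by apply: sumr_ge0.
exists K; elim/ltn_ind => n IHn.
have [nl|ln] := ltnP n l.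
  by rewrite /K (bigD1 (Ordinal nl)) //= lerDl sumr_ge0.
have Cn v : v \in C -> (size v <= n)%N.
  by move=> Cv; apply: leq_trans ln; rewrite /l (big_rem v) //= leq_maxl.
have := language_size_cover Lsh CL Cn.
rewrite -(ler_nat R) natr_sum => /(ler_wpM2r (ltW (exprn_gt0 n x0)))/le_trans; apply.
rewrite mulr_suml; apply: (@le_trans _ _ (\sum_(v <- C) K * x ^+ size v)).
  rewrite !big_seq; apply: ler_sum => v Cv.
  rewrite -{2}(subnK (Cn v Cv)) exprD mulrA ler_wpM2r ?exprn_ge0 ?(ltW x0) //.
  by apply: IHn; rewrite -subn_gt0 subKn ?Cn ?C0.
by rewrite -mulr_sumr ler_piMr.
Qed.

(** * Infinite sums through finite lists, and geometric decay *)

Lemma esum_le_fin (R : realType) (T : choiceType) (C : set T) (f : T -> R) (M : R) :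
  (\esum_(v in C) (f v)%:E <= M%:E)%E <->
  forall s, uniq s -> [set` s] `<=` C -> \sum_(v <- s) f v <= M.
Proof.
split=> [CM s us sC|CM].
  rewrite -lee_fin; apply: le_trans CM; apply: esum_ge; exists [set` s] => //.
  by rewrite -fsbig_seq // sumEFin.
apply: ge_ereal_sup => /= _ [X [/finite_seqP[s ->] sC] <-].
have us : [set` s] = [set` undup s].
  by apply/seteqP; split=> x /=; rewrite mem_undup.
rewrite us -fsbig_seq ?undup_uniq // sumEFin lee_fin CM ?undup_uniq //.
by rewrite -us.
Qed.

Lemma exprn_small (R : realType) (z e : R) : 0 <= z < 1 -> 0 < e ->
  exists n0, forall n, (n0 <= n)%N -> z ^+ n <= e.
Proof.
move=> /andP[z0 z1] e0; have /cvg_expr/cvgrPdist_le/(_ e e0) : `|z| < 1 by rewrite ger0_norm.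
case=> n0 _ zn; exists n0 => n n0n; have := zn n n0n.
by rewrite sub0r normrN ger0_norm // exprn_ge0.
Qed.

(** * Hausdorff measure *)

(* [x] stands for r^(-alpha). *)
Definition cheap (R : realType) (V : finType) (x : R) (L : set (oword V)) n (M : R) :=
  exists2 C, covers L n C &
    forall s, uniq s -> [set` s] `<=` C -> \sum_(v <- s) x ^+ size v <= M.

Definition cost_set (R : realType) (V : finType) (alpha : R) (L : set (oword V)) n :=
  [set (\esum_(v in C) ((r_of V)%:R `^ (- (alpha * (size v)%:R)))%:E)%E
   | C in covers L n].

Lemma powR_weight (R : realType) (r alpha : R) n :
  r `^ (- (alpha * n%:R)) = (r `^ (- alpha)) ^+ n.
Proof. by rewrite -mulNr powRrM powR_mulrn // powR_ge0. Qed.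

Lemma cost_le (R : realType) (V : finType) (alpha : R) (C : set (fword V)) M :
  (\esum_(v in C) ((r_of V)%:R `^ (- (alpha * (size v)%:R)))%:E <= M%:E)%E <->
  forall s, uniq s -> [set` s] `<=` C ->
    \sum_(v <- s) ((r_of V)%:R `^ (- alpha)) ^+ size v <= M.
Proof.
rewrite esum_le_fin; split=> CM s us sC.
  by under eq_bigr do rewrite -powR_weight; apply: CM.
by under eq_bigr do rewrite powR_weight; apply: CM.
Qed.

(** Raising n leaves fewer covers, so the infima increase and their limit is a supremum. *)
Lemma hmeasure_sup (R : realType) (V : finType) (alpha : R) (L : set (oword V)) :
  hmeasure alpha L = ereal_sup (range (fun n => ereal_inf (cost_set alpha L n))).
Proof.
apply/cvg_lim => //; apply: ereal_nondecreasing_cvgn => m n mn.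
apply: ereal_inf_le_tmp => _ [C [Cn CL] <-]; exists C => //; split=> // v /Cn.
exact: leq_trans.
Qed.

Lemma hmeasure_ge0 (R : realType) (V : finType) (alpha : R) (L : set (oword V)) :
  (0 <= hmeasure alpha L)%E.
Proof.
rewrite hmeasure_sup; apply: (@le_trans _ _ (ereal_inf (cost_set alpha L 0))).
  apply: le_ereal_inf_tmp => _ [C _ <-].
  by apply: esum_ge0 => v _; rewrite lee_fin powR_ge0.
by apply: ereal_sup_ubound; exists 0%N.
Qed.

Lemma hmeasure_eq0 (R : realType) (V : finType) (alpha : R) (L : set (oword V)) :
  (forall n (e : R), 0 < e -> cheap ((r_of V)%:R `^ (- alpha)) L n e) ->
  hmeasure alpha L = 0%E.
Proof.
move=> ch; apply/eqP; rewrite eq_le hmeasure_ge0 andbT hmeasure_sup.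
apply: ge_ereal_sup => /= _ [n _ <-]; apply/lee_addgt0Pr => e e0; rewrite add0e.
have [C CL /cost_le Ce] := ch n e e0.
by apply: le_trans Ce; apply: ereal_inf_lbound; exists C.
Qed.

Lemma hmeasure_lt_cheap (R : realType) (V : finType) (alpha M : R) (L : set (oword V)) n :
  (hmeasure alpha L < M%:E)%E -> cheap ((r_of V)%:R `^ (- alpha)) L n M.
Proof.
move=> LM; have : (ereal_inf (cost_set alpha L n) < M%:E)%E.
  by apply: le_lt_trans LM; rewrite hmeasure_sup; apply: ereal_sup_ubound; exists n.
by case/ereal_inf_lt => _ [C CL <-] /ltW/cost_le; exists C.
Qed.

Lemma hmeasure_fin_bound (R : realType) (V : finType) (alpha : R) (L : set (oword V)) :
  hmeasure alpha L != +oo%E -> exists2 M : R, 0 < M & (hmeasure alpha L < M%:E)%E.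
Proof.
have := hmeasure_ge0 alpha L.
case: (hmeasure alpha L) => [h|//|//]; rewrite lee_fin => h0 _.
by exists (h + 1); rewrite ?lte_fin; lra.
Qed.

(** Passing from [alpha] to [beta] multiplies the weight of v by z^|v| with z < 1, uniformly small
    once the cover uses only long words. *)
Lemma hmeasure_jump (R : realType) (V : finType) (alpha beta : R) (L : set (oword V)) :
  (1 < r_of V)%N -> alpha < beta -> hmeasure alpha L != +oo%E ->
  hmeasure beta L = 0%E.
Proof.
move=> r1 ab Lfin; have r0 : 0 < (r_of V)%:R :> R by rewrite ltr0n ltnW.
have [M M0 LM] := hmeasure_fin_bound Lfin.
pose z : R := (r_of V)%:R `^ (alpha - beta).
have z0 : 0 < z by apply: powR_gt0.
have z1 : z < 1.
  rewrite /z /powR gt_eqF // expR_lt1 pmulr_llt0 ?subr_lt0 //.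
  by rewrite ln_gt0 // ltr1n.
have bz : (r_of V)%:R `^ (- beta) = (r_of V)%:R `^ (- alpha) * z.
  by rewrite /z -powRD ?(lt0r_neq0 r0) ?implybT //; congr powR; ring.
apply: hmeasure_eq0 => n e e0.
have [|n0 zn0] := @exprn_small R z (e / M) _ (divr_gt0 e0 M0).
  by rewrite z1 ltW.
have [C [Cn CL] CM] := hmeasure_lt_cheap (maxn n n0) LM.
exists C; first by split=> // v /Cn; apply: leq_trans; rewrite leq_maxl.
move=> s us sC.
apply: (@le_trans _ _ (\sum_(v <- s) (e / M) * ((r_of V)%:R `^ (- alpha)) ^+ size v)).
  rewrite !big_seq; apply: ler_sum => v vs.
  rewrite bz exprMn mulrC ler_wpM2r ?exprn_ge0 ?powR_ge0 //.
  by apply: zn0; apply: leq_trans (Cn v (sC v vs)); rewrite leq_maxr.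
rewrite -mulr_sumr -[leRHS](divfK (lt0r_neq0 M0)) ler_wpM2l ?CM //.
by rewrite divr_ge0 ?ltW.
Qed.

(** Any cover of a non-empty language contains a word, and for negative [alpha] one long word is
    already heavy: here at least 2M > M. *)
Lemma hmeasure_neg (R : realType) (V : finType) (alpha : R) (L : set (oword V)) :
  (1 < r_of V)%N -> L !=set0 -> alpha < 0 -> hmeasure alpha L = +oo%E.
Proof.
move=> r1 [w Lw] a0; apply: contrapT => /eqP Lfin.
have r0 : 0 < (r_of V)%:R :> R by rewrite ltr0n ltnW.
have [M M0 LM] := hmeasure_fin_bound Lfin.
pose z : R := (r_of V)%:R `^ alpha.
have z0 : 0 < z by apply: powR_gt0.
have z1 : z < 1.
  by rewrite /z /powR gt_eqF // expR_lt1 pmulr_llt0 // ln_gt0 // ltr1n.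
have e0 : 0 < (2 * M)^-1 by rewrite invr_gt0; lra.
have [|n0 zn0] := @exprn_small R z _ _ e0; first by rewrite z1 ltW.
have [C [Cn CL] CM] := hmeasure_lt_cheap n0 LM.
have [v Cv _] := CL w Lw.
have /(CM [:: v] isT) : [set` [:: v]] `<=` C by move=> u /=; rewrite inE => /eqP ->.
rewrite big_seq1 powRN -/z exprVn; apply/negP; rewrite -ltNge.
have := zn0 _ (Cn v Cv); rewrite -[leLHS]invrK lef_pV2 ?posrE ?invr_gt0 ?exprn_gt0 //; last by lra.
lra.
Qed.

Lemma hmeasure_count (R : realType) (V : finType) (alpha : R) (L : set (oword V)) :
  (forall n (e : R), 0 < e -> exists2 m, (n <= m)%N &
    (language_size L m)%:R * ((r_of V)%:R `^ (- alpha)) ^+ m <= e) ->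
  hmeasure alpha L = 0%E.
Proof.
move=> Lm; apply: hmeasure_eq0 => n e e0; have [m nm me] := Lm n e e0.
exists [set s | A_of L s /\ size s = m].
  split=> [v [_ ->] //|w Lw]; exists (pre w m); rewrite /is_prefix ?size_pre //.
  by split; rewrite ?size_pre //; exists w; rewrite /is_prefix ?size_pre.
move=> s us sC; apply: le_trans me.
rewrite big_seq (eq_bigr (fun=> ((r_of V)%:R `^ (- alpha)) ^+ m)); last first.
  by move=> v /sC[_ ->].
rewrite -big_seq big_const_seq count_predT iter_addr_0 -[leLHS]mulr_natl.
rewrite ler_wpM2r ?exprn_ge0 ?powR_ge0 // ler_nat /language_size -size_filter.
apply: uniq_leq_size => // v /sC[Av vm].
by rewrite mem_filter mem_words vm eqxx andbT; apply/asboolP.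
Qed.

(** * Existence of the dimension *)

Lemma size_words (T : finType) n : size (words T n) = (#|T| ^ n)%N.
Proof. by elim: n => //= n IHn; rewrite size_allpairs IHn expnS cardT enumT. Qed.

(** The dimension is the infimum of the exponents of finite measure; [hmeasure_jump] gives measure
    zero above it. *)
Lemma hdim_exists (R : realType) (V : finType) (L : set (oword V)) :
  (1 < r_of V)%N -> L !=set0 -> exists d : R, is_hdim L d.
Proof.
move=> r1 L0; have r0 : 0 < (r_of V)%:R :> R by rewrite ltr0n ltnW.
pose E := [set a : R | hmeasure a L != +oo%E].
have Elb : lbound E 0.
  move=> a; apply: contraPT; rewrite -ltNge => a0.
  by rewrite /E /= hmeasure_neg ?eqxx.
(* There are at most r^m prefixes of length m, so at exponent 2 they weigh at most r^(-m). *)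
have E2 : E 2.
  rewrite /E /= hmeasure_count // => n e e0.
  have [|n0 rn] := @exprn_small R (r_of V)%:R^-1 e _ e0.
    by rewrite invr_ge0 ler0n /= invf_lt1 ?ltr1n.
  exists (maxn n n0); first exact: leq_maxl.
  set m := maxn n n0; apply: le_trans (rn m (leq_maxr _ _)).
  have szm : (language_size L m)%:R <= (r_of V)%:R ^+ m :> R.
    by rewrite -natrX ler_nat -[X in (_ <= X)%N]size_words count_size.
  have -> : (r_of V)%:R `^ (- 2) = (r_of V)%:R ^- 2 :> R.
    by rewrite powRN powR_mulrn // ltW.
  apply: le_trans (ler_wpM2r _ szm) _; first by rewrite exprn_ge0 // invr_ge0 exprn_ge0 // ltW.
  by rewrite -exprMn expr2 invfM mulrA divff ?gt_eqF // mul1r.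
exists (inf E); split=> a ha; last first.
  have [b Eb ba] : exists2 b, E b & b < a by apply: inf_lt ha; exists 2.
  exact: hmeasure_jump Eb.
apply: contrapT => /eqP Ea; have := @ge_inf _ E (ex_intro _ 0 Elb) a Ea.
by rewrite leNgt ha.
Qed.

(** * Growth of the language and the dimension gap *)

Lemma hmeasure0_language_size (R : realType) (V : finType) (alpha : R) (L : set (oword V)) :
  (1 < r_of V)%N -> shift_invariant L -> prefix_closed_language L ->
  hmeasure alpha L = 0%E ->
  exists K, forall n, (language_size L n)%:R * ((r_of V)%:R `^ (- alpha)) ^+ n <= K.
Proof.
move=> r1 Lsh Lcl L0; have : (hmeasure alpha L < 1%:E)%E by rewrite L0 lte_fin.
(* Index 1 makes all cover words non-empty, as the recursion in [language_size_bound] requires. *)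
case/(hmeasure_lt_cheap 1) => C [Cn CL] C1.
have [l lP] := finite_subcover Lcl CL.
pose s := [seq v <- undup (flatten [seq words (letter V) k | k <- iota 0 l.+1]) | `[<C v>]].
have sC v : v \in s -> C v by rewrite mem_filter => /andP[/asboolP].
apply: (@language_size_bound _ _ _ s) => //.
- by rewrite powR_gt0 // ltr0n ltnW.
- move=> w /lP[v [Cv vl vw]]; exists v => //.
  rewrite mem_filter mem_undup; apply/andP; split; first exact/asboolP.
  by apply/flatten_mapP; exists (size v); rewrite ?mem_iota ?mem_words.
- by move=> v /sC/Cn.
- by apply: C1 => [|v /sC //]; rewrite filter_uniq ?undup_uniq.
Qed.

Theorem theorem2 (R : realType) (V : finType) (B1 B2 : bexp V) :
  Linv B1 !=set0 ->
  Linv B2 !=set0 ->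
  (forall w, sat_inv B1 w -> sat_inv B2 w) ->
  ~ (forall w, sat_inv B2 w -> sat_inv B1 w) ->
  strongly_connected (Linv B2) ->
  exists d1 d2 : R, [/\ is_hdim (Linv B1) d1, is_hdim (Linv B2) d2 & d1 < d2].
Proof.
move=> L1 L2 B12 /existsNP[w /not_implyP[B2w /existsNP[j nB1]]] sc.
(* Over a one-letter alphabet [w] would coincide with a word of the first language. *)
have r1 : (1 < r_of V)%N.
  rewrite ltnNge; apply/negP => /card_le1_eqP all1.
  have [w1 Bw1] := L1; apply: nB1.
  by rewrite (all1 (w1 j) (w j)) // (all1 (w1 j.+1) (w j.+1)).
have r0 : 0 < (r_of V)%:R :> R by rewrite ltr0n ltnW.
have [a [la fulla toa]] := full_letter L2 sc.
have live12 x : live B1 x -> live B2 x.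
  by move=> /asboolP[v /B12 Bv vx]; apply/asboolP; exists v.
(* The implication concerns whole words, so the edge is first extended to a word of the first
   language. *)
have e12 : subrel (edge B1) (edge B2).
  move=> x y /and3P[lx ly xy]; rewrite /edge !live12 //=.
  have /A_of_Linv : live B1 x && path (edge B1) x [:: y].
    by rewrite lx /= /edge lx ly xy.
  case=> v /B12/(_ 0%N) Bv [vx vy].
  by rewrite vx vy.
have eD x y : edge B2 x y -> live B2 x && live B2 y by case/and3P => -> ->.
have [|M [c [M0 c0 wc]]] := walks_contraction e12 eD la fulla toa (edge_Linv j B2w).
  by rewrite /edge; apply/and3P => -[_ _ /nB1].
pose rho : R := c%:R / c.+1%:R.
have rho0 : 0 < rho by rewrite divr_gt0 ?ltr0n.
have rho1 : rho < 1 by rewrite ltr_pdivrMr ?ltr0n // mul1r ltr_nat.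
have cnt k : (language_size (Linv B1) (M * k).+1)%:R <=
    rho ^+ k * (language_size (Linv B2) (M * k).+1)%:R.
  rewrite /rho expr_div_n mulrAC ler_pdivlMr ?exprn_gt0 ?ltr0n //.
  rewrite -!natrX -!natrM ler_nat mulnC !language_sizeS !big_distrr /=.
  rewrite big_mkcond [leqRHS]big_mkcond; apply: leq_sum => x _.
  case: ifPn => // /live12 ->; rewrite !big_distrr /=.
  by apply: leq_sum => y _; apply: wc.
(* Chosen so that y^M = r^(delta M) = rho^(-1/2), hence rho y^M = rho^(1/2) < 1. *)
pose delta : R := - ln rho / (2 * M%:R * ln (r_of V)%:R).
pose y : R := (r_of V)%:R `^ delta.
have lnr : 0 < ln ((r_of V)%:R : R) by rewrite ln_gt0 // ltr1n.
have lnrho : ln rho < 0 by rewrite ln_lt0 // rho0.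
have Mr : 0 < M%:R :> R by rewrite ltr0n.
have delta0 : 0 < delta by rewrite divr_gt0 ?oppr_gt0 // !mulr_gt0.
have y0 : 0 < y by apply: powR_gt0.
have zy : 0 <= rho * y ^+ M < 1.
  rewrite mulr_ge0 ?exprn_ge0 ?(ltW rho0) ?(ltW y0) //=.
  rewrite -[rho in X in X < _]lnK ?posrE // /y /powR gt_eqF // -expRM_natl -expRD expR_lt1.
  have -> : M%:R * (delta * ln (r_of V)%:R) = - ln rho / 2.
    by rewrite /delta; field; rewrite !gt_eqF.
  lra.
have gap alpha : hmeasure alpha (Linv B2) = 0%E -> hmeasure (alpha - delta) (Linv B1) = 0%E.
  move=> /(hmeasure0_language_size r1 (@Linv_shift_invariant _ _) (@Linv_closed _ _))[K KP].
  set x := (r_of V)%:R `^ (- alpha) in KP.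
  have x0 : 0 < x by apply: powR_gt0.
  have K0 : 0 <= K by apply: le_trans (KP 0%N); rewrite mulr_ge0 // exprn_ge0 // ltW.
  apply: hmeasure_count => n e e0.
  (* [K] may be zero; [K + 1] makes the divisor positive. *)
  have Ky : 0 < (K + 1) * y by rewrite mulr_gt0 //; lra.
  have [k0 kP] := exprn_small zy (divr_gt0 e0 Ky).
  pose k := maxn n k0; exists (M * k).+1.
    apply: leqW; apply: leq_trans (leq_maxl n k0) _.
    by rewrite leq_pmull.
  have -> : (r_of V)%:R `^ (- (alpha - delta)) = x * y.
    by rewrite /x /y -powRD ?(lt0r_neq0 r0) ?implybT //; congr powR; ring.
  (* With m = Mk+1: N1(m)(xy)^m <= rho^k N2(m) x^m y^m <= K y (rho y^M)^k. *)
  apply: (@le_trans _ _ (K * (y * (rho * y ^+ M) ^+ k))).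
    apply: le_trans (ler_wpM2r _ (cnt k)) _.
      by rewrite exprn_ge0 // mulr_ge0 ?ltW.
    rewrite [leLHS](_ : _ = (language_size (Linv B2) (M * k).+1)%:R * x ^+ (M * k).+1
      * (y * (rho * y ^+ M) ^+ k)); last first.
      by rewrite !exprMn -exprM [y ^+ (M * k).+1]exprS; ring.
    by rewrite ler_wpM2r // mulr_ge0 ?exprn_ge0 ?(ltW y0) //; case/andP: zy.
  have := kP k (leq_maxr _ _); rewrite ler_pdivlMr // => kle; apply: le_trans kle.
  set t := (rho * y ^+ M) ^+ k; have t0 : 0 <= y * t.
    by rewrite mulr_ge0 ?exprn_ge0 ?(ltW y0) //; case/andP: zy.
  by rewrite [leRHS]mulrC -mulrA ler_wpM2r // lerDl.
have [d1 [d1oo d10]] := hdim_exists R r1 L1.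
have [d2 [d2oo d20]] := hdim_exists R r1 L2.
exists d1, d2; split=> //.
(* If d2 <= d1, [gap] at d2 + delta/2 makes the first measure vanish at d2 - delta/2 < d1, where it
   is infinite. *)
rewrite ltNge; apply/negP => d21.
have /gap : hmeasure (d2 + delta / 2) (Linv B2) = 0%E by apply: d20; lra.
by rewrite d1oo //; lra.
Qed.
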